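(* Let $R$ be a polynomial ring in finitely many variables over a field, let $I \subseteq R$ be a proper ideal, and let $>_1$ be a term order on $R$. Suppose that $\{b_{i,j} \mid 1 \leq i \leq q,\ 0 \leq j \leq t_i\}$ are distinct variables of $R$ such that: (1) $d_{b_{i,j}}(\mathrm{in}_{>_1}(I)) \leq 1$ for all $1\le i\le q$ and $1\le j \le t_i$; and (2) for each $i = 1, \ldots, q$, if $M$ is a minimal monomial generator of $\mathrm{in}_{>_1}(I)$ and $b_{i,0}$ divides $M$, then there exists $j \geq 1$ such that $b_{i,j}$ divides $M$. Let $f_i = \sum_{j=0}^{t_i} b_{i,j}$ for $1 \leq i \leq q$. Then $f_1, \ldots, f_q$ is an initially regular sequence on $R/I$ with respect to $>_1$ and any term orders $>_2, \ldots, >_q$ for which $b_{i,0} >_{i+1} b_{i,j}$ for all $1 \leq i \leq q-1$ and all $1\le j\le t_i$. In particular, $\mathrm{depth}\, R/I \geq q$.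
   Context: $\mathfrak m$ is the ideal of $R$ generated by all the variables. A term order is a monomial order (a total order on monomials, compatible with multiplication, with $1$ smallest), and $\mathrm{in}_>(J)$ is the initial ideal of $J$ with respect to $>$. For a monomial ideal $J$ and a variable $x$, $d_x(J)$ is the maximum exponent of $x$ in the minimal monomial generators of $J$ (and $0$ if $J=0$). An element $f\in\mathfrak m$ is regular on $R/J$ if it is a non-zerodivisor on $R/J$. For a proper ideal $I$ and term orders $>_1,\dots,>_q$, a sequence of nonconstant polynomials $f_1,\dots,f_q\in\mathfrak m$ is an initially regular sequence on $R/I$ (with respect to $>_1,\dots,>_q$) if for each $i=1,\dots,q$, $f_i$ is a regular element on $R/I_i$, where $I_1=\mathrm{in}_{>_1}(I)$ and $I_i=\mathrm{in}_{>_i}\big((I_{i-1},f_{i-1})\big)$ for $i\ge 2$. Depth is taken with respect to $\mathfrak m$: $\mathrm{depth}\,R/I=\min\{d \mid \mathrm{Ext}^d_R(R/\mathfrak m,R/I)\neq 0\}$ ($+\infty$ if all these vanish). *)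

(* Defs.v *)
From HB Require Import structures.
From mathcomp Require Import all_boot all_order all_algebra.
From mathcomp Require Import boolp classical_sets.
From mathcomp Require Import mpoly.

Set Implicit Arguments.
Unset Strict Implicit.
Unset Printing Implicit Defensive.

Import GRing.Theory.
Local Open Scope classical_set_scope.
Local Open Scope ring_scope.

(* MathComp's [idealr R] is the type of proper ideals given by a boolean
   membership predicate; classically every proper ideal arises this way.
   Ideals that are not known a priori to be proper are sets [set R]. *)

Definition ideal_gen (R : comNzRingType) (A : set R) : set R :=
  [set p | exists k (c g : 'I_k -> R),
     (forall i, A (g i)) /\ p = \sum_(i < k) c i * g i].

Definition regular_mod (R : comNzRingType) (J : set R) (f : R) : Prop :=
  forall g, J (f * g) -> J g.

(* {ideal_quot I} is a comNzRingType in MathComp; this makes it an R-module. *)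
Section QuotientModule.
Variables (R : comNzRingType) (I : idealr R).
Implicit Types (a : R) (x : {ideal_quot I}).

Definition quot_scale a x : {ideal_quot I} := \pi_({ideal_quot I})%qT a * x.

Fact quot_scaleA a b x : quot_scale a (quot_scale b x) = quot_scale (a * b) x.
Proof. by rewrite /quot_scale mulrA rmorphM. Qed.

Fact quot_scale1 : left_id 1 quot_scale.
Proof. by move=> x; rewrite /quot_scale rmorph1 mul1r. Qed.

Fact quot_scaleDr : right_distributive quot_scale +%R.
Proof. by move=> a x y; rewrite /quot_scale mulrDr. Qed.

Fact quot_scaleDl x : {morph quot_scale^~ x : a b / a + b}.
Proof. by move=> a b; rewrite /quot_scale rmorphD mulrDl. Qed.

HB.instance Definition _ := GRing.Zmodule_isLmodule.Build R {ideal_quot I}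
  quot_scaleA quot_scale1 quot_scaleDr quot_scaleDl.

End QuotientModule.

Section Ext.
Variable R : comNzRingType.

Definition projective (P : lmodType R) : Prop :=
  forall (M N : lmodType R) (g : {linear M -> N}) (f : {linear P -> N}),
    (forall y, exists x, g x = y) ->
    exists h : {linear P -> M}, forall x, g (h x) = f x.

Record proj_resolution (M : lmodType R) := ProjResolution {
  res_mod :> nat -> lmodType R;
  res_diff : forall d, {linear res_mod d.+1 -> res_mod d};
  res_aug : {linear res_mod 0%N -> M};
  res_projective : forall d, projective (res_mod d);
  res_aug_surj : forall y, exists x, res_aug x = y;
  res_exact0 : forall x, res_aug x = 0 <-> exists y, res_diff 0%N y = x;
  res_exactS : forall d x,
    res_diff d x = 0 <-> exists y, res_diff d.+1 y = x
}.

Definition cocycle (M N : lmodType R) (P : proj_resolution M) (d : nat)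
    (phi : {linear P d -> N}) : Prop :=
  forall x, phi (res_diff P d x) = 0.

Definition coboundary (M N : lmodType R) (P : proj_resolution M) (d : nat) :
    {linear P d -> N} -> Prop :=
  match d with
  | 0%N => fun phi => forall x, phi x = 0
  | d'.+1 => fun phi =>
      exists psi : {linear P d' -> N}, forall x, phi x = psi (res_diff P d' x)
  end.

(* Ext^d_R(M, N) <> 0. The cohomology of Hom(P, N) does not depend on the
   projective resolution P of M, so the quantifier over P is immaterial. *)
Definition Ext_neq0 (d : nat) (M N : lmodType R) : Prop :=
  exists (P : proj_resolution M) (phi : {linear P d -> N}),
    cocycle phi /\ ~ coboundary phi.

(* min {d | Ext^d_R(R/J, N) <> 0}, with None standing for +oo *)
Definition depth (J : idealr R) (N : lmodType R) : option nat :=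
  match pselect (exists d, `[< Ext_neq0 d {ideal_quot J} N >]) with
  | left exd => Some (ex_minn exd)
  | right _ => None
  end.

End Ext.

Definition le_depth (q : nat) (e : option nat) : Prop :=
  if e is Some d then (q <= d)%N else True.

Section InitialIdeals.
Variables (K : fieldType) (n : nat).
Local Notation R := {mpoly K[n]}.

Definition max_ideal_set : set R := ideal_gen [set 'X_i | i in [set: 'I_n]].

Definition max_ideal : {pred R} := fun p => `[< max_ideal_set p >].

Fact max_ideal_idealr_closed : idealr_closed max_ideal.
Proof.
split.
- by apply/asboolP; exists 0%N, (fun=> 0), (fun=> 0);
    split=> [[]|] //; rewrite big_ord0.
- apply/asboolPn => -[k [c [g [gX /(congr1 (mcoeff 0%MM))]]]].
  rewrite mcoeff1 eqxx raddf_sum /= big1 => [/eqP|i _]; first by rewrite oner_eq0.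
  have [j _ <-] := gX i.
  by rewrite (rmorphM (mcoeff 0%MM)) /= mcoeffX mnm1_eq0 mulr0.
- move=> a u v /asboolP[k [c [g [gX ->]]]] /asboolP[l [c' [g' [gX' ->]]]].
  apply/asboolP; exists (k + l)%N.
  exists (fun i => match fintype.split i with inl i => a * c i | inr i => c' i end).
  exists (fun i => match fintype.split i with inl i => g i | inr i => g' i end).
  split=> [i|]; first by case: fintype.split.
  rewrite big_split_ord /= mulr_sumr; congr (_ + _); apply: eq_bigr => i _.
    by rewrite (unsplitK (inl i)) mulrA.
  by rewrite (unsplitK (inr i)).
Qed.

HB.instance Definition _ := isIdealr.Build R max_ideal max_ideal_idealr_closed.

(* [le m1 m2] reads m1 <= m2 *)
Record term_order (le : rel 'X_{1..n}) : Prop := TermOrder {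
  term_order_anti : antisymmetric le;
  term_order_trans : transitive le;
  term_order_total : total le;
  term_order_min : forall m, le 0%MM m;
  term_order_mul : forall m m1 m2, le m1 m2 -> le (m1 + m)%MM (m2 + m)%MM
}.

Definition term_gt (le : rel 'X_{1..n}) (m1 m2 : 'X_{1..n}) : bool :=
  (m1 != m2) && le m2 m1.

Definition lead_monomial (le : rel 'X_{1..n}) (p : R) (m : 'X_{1..n}) : Prop :=
  m \in msupp p /\ {in msupp p, forall m', le m' m}.

Definition initial_ideal (le : rel 'X_{1..n}) (J : set R) : set R :=
  ideal_gen [set 'X_[m] | m in
    [set m | exists2 p, J p & lead_monomial le p m]].

Definition min_gens (J : set R) : set 'X_{1..n} :=
  [set m | J 'X_[m] /\
     forall m', J 'X_[m'] -> (m' <= m)%MM -> m' = m].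

(* d_x(J) for the x-th variable; by Dickson's lemma the supremum is the maximum
   of a finite set of exponents when J <> 0. *)
Definition max_exponent (x : 'I_n) (J : set R) : nat :=
  supremum 0%N [set m x | m in min_gens J].

(* Indices start at 1: [init_seq le f I i] is the ideal I_i attached to the term
   orders le 1, le 2, ... and the polynomials f 1, f 2, ... *)
Fixpoint init_seq (le : nat -> rel 'X_{1..n}) (f : nat -> R) (I : set R)
    (i : nat) : set R :=
  match i with
  | 0%N => I
  | 1%N => initial_ideal (le 1%N) I
  | (i'.+1 as i1).+1 =>
      initial_ideal (le i) (ideal_gen (init_seq le f I i1 `|` [set f i1]))
  end.

Definition initially_regular (le : nat -> rel 'X_{1..n}) (q : nat)
    (f : nat -> R) (I : set R) : Prop :=
  forall i, (1 <= i <= q)%N ->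
    [/\ max_ideal_set (f i),
        forall c : K, f i <> c%:MP
      & regular_mod (init_seq le f I i) (f i)].

End InitialIdeals.

Arguments max_ideal K n : clear implicits.

(* Main.v *)
(* The sums of distinct variables f_i satisfy two independent facts.

   Combinatorics. For a monomial ideal J, the ideal (J, f_i) is graded by the
   exponents of the variables not occurring in f_i. Hence, for such a variable x,
   every minimal generator N of in(J, f_i) divisible by x is accompanied by a
   minimal generator M of J with the same exponent of x and with exponents at most
   those of N outside f_i. Conditions (1) and (2) for f_{i+1}, ..., f_q therefore
   pass from I_i to I_{i+1}, for any term order, and for a monomial ideal they make
   the sum of the variables regular.

   Depth. Write H^j(N) for the Koszul cohomology of the variables. If H^j(R/in(J))
   vanishes for j < k, so does H^j(R/J), by filtering the Koszul complex by the
   Z^n-degrees of leading terms. If f in the maximal ideal is regular on R/J and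
   H^j(R/(J, f)) = 0 for j < k, then H^j(R/J) = 0 for j <= k. So an initially
   regular sequence of length q makes H^j(R/I) vanish for j < q, and the double
   complex Hom(P_a, K^b(R/I)) turns this into the vanishing of Ext^j. *)

Require Import Defs.
From HB Require Import structures.
From mathcomp Require Import all_boot all_order all_algebra.
From mathcomp Require Import boolp classical_sets.
From mathcomp Require Import mpoly.

Set Implicit Arguments.
Unset Strict Implicit.
Unset Printing Implicit Defensive.

Import GRing.Theory.
Local Open Scope classical_set_scope.
Local Open Scope ring_scope.

(** * Koszul cohomology *)

Section Koszul.
Variables (R : comNzRingType) (n : nat).
Implicit Types (j k : 'I_n) (T : {set 'I_n}).

Definition ksign j T : R := (-1) ^+ #|[set k in T | (k < j)%N]|.

Lemma ksign_sqr j T : ksign j T * ksign j T = 1.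
Proof. by rewrite /ksign -exprD -signr_odd oddD addbb. Qed.

Lemma ksignD1 j k T : k \in T -> ksign j T = (-1) ^+ (k < j)%N * ksign j (T :\ k).
Proof.
move=> kT; rewrite /ksign -exprD; congr (_ ^+ _).
rewrite (cardsD1 k) inE kT /=; congr (_ + _)%N.
by apply: eq_card => l; rewrite !inE andbA.
Qed.

Lemma ksignD1_id j T : ksign j (T :\ j) = ksign j T.
Proof.
have [jT|jT] := boolP (j \in T); first by rewrite (ksignD1 j jT) ltnn mul1r.
congr ksign; apply/setP=> l; rewrite !inE.
by have [->|] := eqVneq l j; rewrite ?(negPf jT).
Qed.

Lemma ksign_anti j k T : j \in T -> k \in T -> j != k ->
  ksign j T * ksign k (T :\ j) = - (ksign k T * ksign j (T :\ k)).
Proof.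
move=> jT kT njk; rewrite (ksignD1 j kT) (ksignD1 k jT).
have := njk; rewrite -val_eqE neq_ltn => /orP[] h;
  rewrite h (ltnNge _ _) (ltnW h) /= expr0 expr1 !(mul1r, mulN1r, mulNr, opprK) mulrC //.
Qed.

Variables (x : 'I_n -> R) (N : lmodType R).
Implicit Types (c : {set 'I_n} -> N) (J : set N).

Definition kdiff c T : N := \sum_(j in T) (ksign j T * x j) *: c (T :\ j).

Lemma eq_kdiff c c' T : (forall S : {set 'I_n}, #|S|.+1 = #|T| -> c S = c' S) ->
  kdiff c T = kdiff c' T.
Proof.
move=> ecc'; apply: eq_bigr => j jT; rewrite ecc' //.
by rewrite [RHS](cardsD1 j) jT.
Qed.

Lemma kdiff_sum (I : finType) (a : I -> R) (c : I -> {set 'I_n} -> N) T :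
  kdiff (fun S => \sum_i a i *: c i S) T = \sum_i a i *: kdiff (c i) T.
Proof.
under [RHS]eq_bigr do rewrite scaler_sumr.
rewrite exchange_big; apply: eq_bigr => j _; rewrite scaler_sumr.
by apply: eq_bigr => i _; rewrite !scalerA mulrC.
Qed.

Lemma kdiffD c c' T : kdiff (fun S => c S + c' S) T = kdiff c T + kdiff c' T.
Proof. by rewrite -big_split; apply: eq_bigr => j _; rewrite scalerDr. Qed.

Lemma kdiffZ a c T : kdiff (fun S => a *: c S) T = a *: kdiff c T.
Proof.
by rewrite scaler_sumr; apply: eq_bigr => j _; rewrite !scalerA mulrC.
Qed.

Lemma kdiffB c c' T : kdiff (fun S => c S - c' S) T = kdiff c T - kdiff c' T.
Proof.
rewrite -scaleN1r -kdiffZ -kdiffD; apply: eq_kdiff => S _.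
by rewrite scaleN1r.
Qed.

Lemma kdiff_kdiff c T : kdiff (kdiff c) T = 0.
Proof.
pose F j k := (ksign j T * ksign k (T :\ j) * (x j * x k)) *: c (T :\ j :\ k).
pose G (p : 'I_n * 'I_n) := F p.1 p.2.
pose Q (p : 'I_n * 'I_n) := [&& p.1 \in T, p.2 \in T & p.2 != p.1].
have -> : kdiff (kdiff c) T = \sum_(p | Q p) G p.
  rewrite /kdiff; under eq_bigr do rewrite scaler_sumr.
  rewrite pair_big_dep; apply: eq_big => -[j k] /=.
    by rewrite /Q /= !inE; case: (j \in T); rewrite //= andbC.
  by move=> _; rewrite /G /F scalerA mulrACA.
rewrite (bigID (fun p : 'I_n * 'I_n => (p.1 < p.2)%N)) /=.
rewrite addrC (reindex_inj (h := fun p : 'I_n * 'I_n => (p.2, p.1))) /=; last first.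
  by move=> [a b] [a' b'] [-> ->].
apply/eqP; rewrite addr_eq0 -sumrN; apply/eqP.
apply: eq_big => -[j k]; rewrite /Q /=.
  rewrite -leqNgt [k == j]eq_sym andbCA -!andbA; do 2 congr (_ && _).
  by rewrite [in RHS]ltn_neqAle [in RHS]val_eqE andbA andbb.
case/andP=> /and3P[kT jT njk] _; rewrite /G /F /=.
rewrite [ksign j T * _]ksign_anti // mulNr scaleNr opprK [x k * _]mulrC.
by congr (_ *: c _); apply/setP=> l; rewrite !inE andbCA.
Qed.

Definition kcontr j c T : N :=
  if j \in T then 0 else ksign j T *: c (j |: T).

Lemma kdiff_kcontr j c T :
  kdiff (kcontr j c) T + kcontr j (kdiff c) T = x j *: c T.
Proof.
rewrite {2}/kcontr; case: ifPn => jT.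
  rewrite addr0 /kdiff (bigD1 j) //= big1 => [|k /andP[kT nkj]].
    rewrite addr0 /kcontr !inE eqxx /= scalerA ksignD1_id finset.setD1K // mulrAC.
    by rewrite ksign_sqr mul1r.
  by rewrite /kcontr !inE eq_sym nkj jT scaler0.
have jjT : j \in j |: T by rewrite finset.setU11.
have jTj : (j |: T) :\ j = T by rewrite finset.setU1K.
rewrite [X in _ + _ *: X]/kdiff (bigD1 j) //= jTj scalerDr scalerA.
rewrite -[ksign j (_ |: _)]ksignD1_id jTj mulrA ksign_sqr mul1r.
rewrite addrCA -[RHS]addr0; congr (_ + _).
rewrite scaler_sumr /kdiff.
rewrite [X in _ + X](eq_bigl (fun k => k \in T)); last first.
  move=> k; rewrite !inE; have [->|] := eqVneq k j; last by rewrite andbT.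
  by rewrite (negPf jT).
rewrite -big_split big1 // => k kT /=.
have nkj : k != j by apply: contraNneq jT => <-.
rewrite /kcontr !inE [j == k]eq_sym (negPf nkj) (negPf jT) /= !scalerA.
have -> : j |: T :\ k = (j |: T) :\ k.
  by apply/setP=> l; rewrite !inE; have [->|] := eqVneq l j; rewrite //= eq_sym nkj.
rewrite -scalerDl !mulrA.
have kT' : k \in j |: T by rewrite !inE kT orbT.
rewrite mulrAC -mulrDl.
have e1 : ksign j ((j |: T) :\ k) = ksign j (T :\ k).
  rewrite -ksignD1_id; congr ksign; apply/setP=> l; rewrite !inE.
  have [->|] //= := eqVneq l j.
  by rewrite (negPf jT) andbF.
have e2 : ksign j (j |: T) = ksign j T by rewrite -ksignD1_id jTj.
have := ksign_anti kT' jjT nkj; rewrite jTj e1 e2 => e3.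
suff -> : ksign k T * ksign j (T :\ k) = - (ksign j T * ksign k (j |: T)).
  by rewrite addNr mul0r scale0r.
rewrite -[LHS]mulr1 -(ksign_sqr k (j |: T)) mulrACA [ksign j (T :\ k) * _]mulrC.
rewrite e3 mulrN [ksign j T * ksign k T]mulrC mulrACA ksign_sqr mul1r.
by rewrite [ksign k _ * _]mulrC.
Qed.

Definition koszul_exact q J : Prop :=
  forall i c, (i < q)%N ->
    (forall T, #|T| = i.+1 -> J (kdiff c T)) ->
    exists c', forall T, #|T| = i -> J (c T - kdiff c' T).

Lemma eq_koszul_exact q J J' : (forall y, J y <-> J' y) ->
  koszul_exact q J -> koszul_exact q J'.
Proof. by move=> eJJ'; congr koszul_exact; apply/predeqP. Qed.

Definition submodule_set J : Prop :=
  J 0 /\ forall a u v, J u -> J v -> J (a *: u + v).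

Section SubmoduleSet.
Variables (J : set N) (Jsub : submodule_set J).

Lemma submodule_set0 : J 0. Proof. by case: Jsub. Qed.

Lemma submodule_setZ a u : J u -> J (a *: u).
Proof.
by move=> Ju; rewrite -[_ *: _]addr0; apply Jsub.2 => //; case: Jsub.
Qed.

Lemma submodule_setD u v : J u -> J v -> J (u + v).
Proof. by move=> Ju Jv; rewrite -[u]scale1r; apply Jsub.2. Qed.

Lemma submodule_setN u : J u -> J (- u).
Proof. by rewrite -scaleN1r; exact: submodule_setZ. Qed.

Lemma submodule_setB u v : J u -> J v -> J (u - v).
Proof. by move=> Ju /submodule_setN; exact: submodule_setD. Qed.

Lemma submodule_set_sum (I : Type) (r : seq I) (P : pred I) (F : I -> N) :
  (forall i, P i -> J (F i)) -> J (\sum_(i <- r | P i) F i).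
Proof.
by move=> JF; elim/big_ind: _ => //; [exact: submodule_set0|exact: submodule_setD].
Qed.

(* The homotopies [kcontr j] make f act as zero on Koszul cohomology, so the
   long exact sequence of multiplication by f splits into short ones. *)
Lemma koszul_exact_regular q f (a : 'I_n -> R) :
  f = \sum_j a j * x j -> (forall g, J (f *: g) -> J g) ->
  koszul_exact q [set y | exists2 h, J h & exists g, y = h + f *: g] ->
  koszul_exact q.+1 J.
Proof.
move=> fE freg exq i c; rewrite ltnS => leiq ccy.
pose e S := \sum_j a j *: kcontr j c S.
have fcE T : #|T| = i -> J (f *: c T - kdiff e T).
  move=> cT; rewrite fE scaler_suml kdiff_sum -sumrB.
  apply: submodule_set_sum => j _.
  rewrite -scalerA -kdiff_kcontr scalerDr addrC addKr.
  apply: submodule_setZ; rewrite /kcontr; case: ifPn => jT.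
    exact: submodule_set0.
  by apply/submodule_setZ/ccy; rewrite cardsU1 jT cT.
case: i leiq ccy fcE => [|i] leiq ccy fcE.
  exists (fun=> 0) => T cT; have/cards0_eq T0 := cT.
  move: (fcE T cT); rewrite T0 /kdiff !big_set0 !subr0; exact: freg.
have [|e' e'P] := exq i e leiq.
  move=> T cT; exists (- (f *: c T - kdiff e T)).
    by apply/submodule_setN/fcE.
  by exists (c T); rewrite opprB subrK.
have /choice[g gP] (T : {set 'I_n}) : exists g, #|T| = i -> J (e T - kdiff e' T - f *: g).
  have [cT|] := eqVneq #|T| i; last by move=> nT; exists 0 => /eqP; rewrite (negPf nT).
  have [h Jh [g ->]] := e'P T cT.
  by exists g; rewrite addrK.
exists g => T cT; apply: freg; rewrite scalerBr -kdiffZ.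
rewrite -[f *: c T](subrK (kdiff e T)) -addrA; apply: submodule_setD.
  exact: fcE.
have -> : kdiff e T - kdiff (fun S => f *: g S) T =
          kdiff (fun S => e S - kdiff e' S - f *: g S) T.
  by rewrite !kdiffB kdiff_kdiff subr0.
apply: submodule_set_sum => j jT; apply/submodule_setZ/gP.
by apply/eqP; rewrite -eqSS -cT [X in _ == X](cardsD1 j) jT.
Qed.

End SubmoduleSet.
End Koszul.

(** * From Koszul cohomology to Ext *)

Section ImageModule.
Variables (R : comNzRingType) (A B : lmodType R) (g : {linear A -> B}).

Definition lin_image : {pred B} := fun y => `[< exists x, g x = y >].

Fact lin_image_submod_closed : submod_closed lin_image.
Proof.
split=> [|a u v /asboolP[x <-] /asboolP[y <-]]; apply/asboolP.
  by exists 0; rewrite linear0.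
by exists (a *: x + y); rewrite linearP.
Qed.

HB.instance Definition _ := GRing.isSubmodClosed.Build R B lin_image lin_image_submod_closed.

Record image_module := ImageModule { image_val : B; _ : image_val \in lin_image }.

HB.instance Definition _ := [isSub for image_val].
HB.instance Definition _ := [Choice of image_module by <:].
HB.instance Definition _ := [SubChoice_isSubLmodule of image_module by <:].

End ImageModule.

Section Lift.
Variable R : comNzRingType.

Lemma linear_fun0 (A B : lmodType R) (f : A -> B) : linear f -> f 0 = 0.
Proof.
by move=> flin; have := flin (-1) 0 0; rewrite scaler0 addr0 scaleN1r addNr.
Qed.

Lemma projective_lift (P A B : lmodType R) (f : P -> B) (g : A -> B) :
  projective P -> linear f -> linear g -> (forall p, exists a, g a = f p) ->
  exists2 h : P -> A, linear h & forall p, g (h p) = f p.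
Proof.
move=> projP flin glin fg.
pose g1 : {linear A -> B} := HB.pack g (GRing.isLinear.Build R A B *:%R g glin).
have fP p : f p \in lin_image g1 by apply/asboolP/fg.
have gP a : g a \in lin_image g1 by apply/asboolP; exists a.
pose f2 p : image_module g1 := ImageModule (fP p).
pose g2 a : image_module g1 := ImageModule (gP a).
have f2lin : linear f2 by move=> a u v; apply: val_inj; rewrite /= flin.
have g2lin : linear g2 by move=> a u v; apply: val_inj; rewrite /= glin.
pose f3 : {linear P -> image_module g1} :=
  HB.pack f2 (GRing.isLinear.Build R _ _ *:%R f2 f2lin).
pose g3 : {linear A -> image_module g1} :=
  HB.pack g2 (GRing.isLinear.Build R _ _ *:%R g2 g2lin).
have [|h hP] := projP _ _ g3 f3.
  by case=> y yP; have /asboolP[x xy] := yP; exists x; apply: val_inj.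
by exists h => [|p]; [exact: linearP|have := congr1 val (hP p)].
Qed.

End Lift.

Section ExtKoszul.
Variables (R : comNzRingType) (n : nat) (x : 'I_n -> R) (M N : lmodType R).
Hypothesis xM : forall j (u : M), x j *: u = 0.
Variable P : proj_resolution M.
Local Notation F := {ffun {set 'I_n} -> N}.
Local Notation d_ := (res_diff P).

Lemma res_diff_diff d p : d_ d (d_ d.+1 p) = 0.
Proof. by apply/res_exactS; exists p. Qed.

Lemma null_homotopy j d : exists2 s : P d -> P d.+1, linear s &
  forall p, d_ d (s (d_ d p)) = x j *: d_ d p.
Proof.
elim: d => [|d [s slin sP]].
  have [| | |s slin sP] := @projective_lift R (P 0%N) (P 1%N) (P 0%N)
      (fun p => x j *: p) (d_ 0%N) (@res_projective _ _ P _).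
  - by move=> a u v; rewrite scalerDr !scalerA mulrC.
  - exact: linearP.
  - by move=> p; apply/res_exact0; rewrite linearZ /= xM.
  by exists s => // p; rewrite sP.
have [| | |s' slin' sP'] := @projective_lift R (P d.+1) (P d.+2) (P d.+1)
    (fun p => x j *: p - s (d_ d p)) (d_ d.+1) (@res_projective _ _ P _).
- move=> a u v; rewrite linearP slin scalerBr scalerDr !scalerA mulrC.
  by rewrite opprD addrACA.
- exact: linearP.
- by move=> p; apply/res_exactS; rewrite linearB linearZ /= sP subrr.
exists s' => // p; rewrite sP' res_diff_diff.
by rewrite linear_fun0 ?subr0.
Qed.

Lemma cocycle_scale_coboundary j d (phi : P d.+1 -> N) : linear phi ->
  (forall p, phi (d_ d.+1 p) = 0) ->
  exists2 psi : P d -> N, linear psi & forall p, x j *: phi p = psi (d_ d p).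
Proof.
move=> philin phi0; have [s slin sP] := null_homotopy j d.
exists (phi \o s) => [a u v|p] /=; first by rewrite slin philin.
have /res_exactS[r rP] : d_ d (x j *: p - s (d_ d p)) = 0.
  by rewrite linearB linearZ /= sP subrr.
have := phi0 r; rewrite rP.
have -> : x j *: p - s (d_ d p) = (-1) *: s (d_ d p) + x j *: p.
  by rewrite scaleN1r addrC.
rewrite philin -[x j *: p]addr0 philin linear_fun0 // addr0 scaleN1r.
by move/eqP; rewrite addrC subr_eq0 => /eqP.
Qed.

Lemma kdiff_linear (T : {set 'I_n}) : linear (fun c : F => kdiff x c T).
Proof.
move=> a u v; rewrite -kdiffZ -kdiffD; apply: eq_kdiff => S _.
by rewrite !ffunE.
Qed.

Variable q : nat.
Hypothesis Nex : koszul_exact x q [set (0 : N)].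

Lemma koszul_lift a b (psi : P a -> F) : linear psi -> (b < q)%N ->
  (forall p (T : {set 'I_n}), #|T| = b.+1 -> kdiff x (psi p) T = 0) ->
  exists2 eta : P a -> F, linear eta &
    forall p (T : {set 'I_n}), #|T| = b -> psi p T = kdiff x (eta p) T.
Proof.
move=> psilin ltbq psi0.
pose trunc (c : {set 'I_n} -> N) : F := [ffun T : {set 'I_n} => if #|T| == b then c T else 0].
have [| | |eta etalin etaP] := @projective_lift R (P a) F F
    (fun p => trunc (psi p)) (fun c => trunc (kdiff x c)) (@res_projective _ _ P _).
- move=> l u v; apply/ffunP=> T; rewrite !ffunE psilin !ffunE.
  by case: ifP; rewrite // scaler0 addr0.
- move=> l u v; apply/ffunP=> T; rewrite !ffunE kdiff_linear.
  by case: ifP; rewrite // scaler0 addr0.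
- move=> p; have [c' c'P] := Nex ltbq (psi0 p).
  exists [ffun T => c' T]; apply/ffunP=> T; rewrite !ffunE.
  case: ifP => // /eqP/c'P/eqP; rewrite subr_eq0 => /eqP->.
  by apply: eq_kdiff => S _; rewrite ffunE.
exists eta => // p T cT; have := congr1 (fun c : F => c T) (etaP p).
by rewrite !ffunE cT eqxx.
Qed.

Definition coboundary_fun (V : lmodType R) a : (P a -> V) -> Prop :=
  match a with
  | 0%N => fun phi => forall p, phi p = 0
  | a'.+1 => fun phi =>
      exists2 psi : P a' -> V, linear psi & forall p, phi p = psi (d_ a' p)
  end.

Lemma coboundary_fun_cocycle (V : lmodType R) a (phi : P a -> V) p :
  coboundary_fun phi -> phi (d_ a p) = 0.
Proof.
case: a phi p => [|a] phi p /= => [->//|[psi psilin ->]].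
by rewrite res_diff_diff linear_fun0.
Qed.

Definition Ext_zero a := forall phi : P a -> N, linear phi ->
  (forall p, phi (d_ a p) = 0) -> coboundary_fun phi.

(* Diagram chase in the double complex Hom(P_a, K^b(N)), whose rows are exact
   because the P_a are projective. *)
Lemma double_complex_exact a b (psi : P a -> F) :
  (forall a', (a' <= a)%N -> Ext_zero a') -> (a + b < q)%N -> linear psi ->
  (forall p (T : {set 'I_n}), #|T| = b.+1 -> kdiff x (psi (d_ a p)) T = 0) ->
  exists eta theta : P a -> F, [/\ linear eta, coboundary_fun theta &
    forall p (T : {set 'I_n}), #|T| = b -> psi p T = kdiff x (eta p) T + theta p T].
Proof.
elim: a b psi => [|a IHa] b psi exta ltabq psilin psi0.
  have [|eta etalin etaP] := @koszul_lift 0%N b psi psilin ltabq.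
    move=> p T cT; apply: (exta 0%N isT (fun p => kdiff x (psi p) T)).
      by move=> l u v; rewrite psilin kdiff_linear.
    by move=> r; exact: psi0.
  exists eta, (fun=> 0); split=> // p T cT.
  by rewrite ffunE addr0 etaP.
have /choice[om omP] (T : {set 'I_n}) : exists om : P a -> N, #|T| = b.+1 ->
    linear om /\ forall p, kdiff x (psi p) T = om (d_ a p).
  have [cT|/eqP nT] := eqVneq #|T| b.+1; last by exists (fun=> 0).
  have [||om omlin omP] := exta a.+1 (leqnn _) (fun p => kdiff x (psi p) T).
  - by move=> l u v; rewrite psilin kdiff_linear.
  - by move=> r; exact: psi0.
  by exists om.
pose omega p : F := [ffun T : {set 'I_n} => if #|T| == b.+1 then om T p else 0].
have omegaE p (T : {set 'I_n}) : #|T| = b.+1 -> kdiff x (psi p) T = omega (d_ a p) T.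
  by move=> cT; rewrite ffunE cT eqxx; have [_ ->] := omP T cT.
have [||||eta [theta [etalin thetab etaP]]] := IHa b.+1 omega.
- by move=> a' lea'; apply: exta; exact: leqW.
- by rewrite addnS -addSn.
- move=> l u v; apply/ffunP=> T; rewrite !ffunE.
  case: ifP => [/eqP/omP[-> //]|_]; by rewrite scaler0 addr0.
- move=> p T cT; rewrite -[RHS](kdiff_kdiff x (psi p) T); apply: eq_kdiff => S.
  by rewrite cT => -[cS]; rewrite omegaE.
have thetac p : theta (d_ a p) = 0 by apply: coboundary_fun_cocycle.
have [| | |eta' etalin' etaP'] := @koszul_lift a.+1 b (fun p => psi p - eta (d_ a p)).
- move=> l u v; rewrite linearP psilin etalin scalerBr.
  by rewrite opprD addrACA.
- by apply: leq_ltn_trans ltabq; rewrite leq_addl.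
- move=> p T cT.
  have -> : kdiff x (psi p - eta (d_ a p)) T = kdiff x (psi p) T - kdiff x (eta (d_ a p)) T.
    by rewrite -kdiffB; apply: eq_kdiff => S _; rewrite !ffunE.
  by rewrite omegaE // etaP // thetac ffunE addr0 subrr.
exists eta', (fun p => eta (d_ a p)); split=> //; first by exists eta.
move=> p T cT; have := etaP' p T cT; rewrite !ffunE => <-.
by rewrite subrK.
Qed.

Lemma koszul_exact_Ext_zero d : (d < q)%N -> Ext_zero d.
Proof.
elim/ltn_ind: d => d IHd ltdq phi philin phi0.
have degree0 (u : N) : (forall j, x j *: u = 0) -> u = 0.
  move=> xu; have [|c' c'P] := Nex (c := fun=> u) (leq_ltn_trans (leq0n d) ltdq).
    move=> T _; rewrite /= /kdiff big1 // => j _.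
    by rewrite -scalerA xu scaler0.
  by have := c'P finset.set0 (cards0 _); rewrite /kdiff big_set0 subr0.
case: d IHd ltdq phi philin phi0 => [|d] IHd ltdq phi philin phi0.
  move=> p; apply: degree0 => j.
  have /res_exact0[r rP] : res_aug P (x j *: p) = 0 by rewrite linearZ /= xM.
  have := phi0 r; rewrite rP -[x j *: p]addr0 philin.
  by rewrite linear_fun0 ?addr0.
have /choice[om omP] (j : 'I_n) : exists om : P d -> N,
    linear om /\ forall p, x j *: phi p = om (d_ d p).
  by have [om omlin omP] := cocycle_scale_coboundary j philin phi0; exists om.
pose psi p : F := [ffun T : {set 'I_n} => \sum_(j in T) ksign R j T *: om j p].
have psiE p T : psi (d_ d p) T = kdiff x (fun=> phi p) T.
  rewrite ffunE; apply: eq_bigr => j _.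
  by rewrite -scalerA; have [_ ->] := omP j.
have [||||eta [theta [etalin thetab etaP]]] := @double_complex_exact d 1 psi.
- by move=> a' lea'; apply: IHd; rewrite ?ltnS //; exact: leq_ltn_trans lea' (ltnW ltdq).
- by rewrite addn1.
- move=> a u v; apply/ffunP=> T; rewrite !ffunE scaler_sumr -big_split.
  apply: eq_bigr => j _ /=; have [-> _] := omP j.
  by rewrite scalerDr !scalerA mulrC.
- move=> p T _; rewrite -[RHS](kdiff_kdiff x (fun=> phi p) T).
  by apply: eq_kdiff => S _; rewrite psiE.
exists (fun p => eta p finset.set0) => [a u v|p]; first by rewrite /= etalin !ffunE.
apply/eqP; rewrite -subr_eq0; apply/eqP; apply: degree0 => j.
have thetac p' : theta (d_ d p') = 0 by exact: coboundary_fun_cocycle.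
have := psiE p [set j]%SET; rewrite etaP ?cards1 // thetac ffunE addr0.
rewrite /kdiff !big_set1 finset.setDv -!scalerA => /(congr1 (fun u => ksign R j [set j]%SET *: u)).
by rewrite !scalerA ksign_sqr !mul1r scalerBr => ->; rewrite subrr.
Qed.

End ExtKoszul.

Lemma koszul_exact_depth (R : comNzRingType) n (x : 'I_n -> R) (J : idealr R)
    (N : lmodType R) q :
  (forall j, x j \in J) -> koszul_exact x q [set (0 : N)] ->
  le_depth q (depth J N).
Proof.
move=> xJ exq; rewrite /le_depth /depth; case: pselect => // exd.
case: ex_minnP => d /asboolP[P [phi [phi0 nphi]]] _.
rewrite leqNgt; apply/negP => ltdq; apply: nphi.
have xk j (u : {ideal_quot J}) : x j *: u = 0.
  elim/quotW: u => u; rewrite /GRing.scale /= /quot_scale -rmorphM /=.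
  rewrite -[RHS](rmorph0 (\pi_({ideal_quot J})%qT)); apply/eqP.
  by rewrite -Quotient.idealrBE subr0 mulrC idealMr.
have := koszul_exact_Ext_zero xk exq ltdq (linearP phi) phi0.
case: d P phi phi0 {ltdq} => [|d] P phi phi0 //= [psi psilin psiP].
pose psi1 : {linear P d -> N} := HB.pack psi (GRing.isLinear.Build R _ _ *:%R psi psilin).
by exists psi1.
Qed.

(** * Monomials and term orders *)

Section Monomials.
Variable n : nat.
Implicit Types (m : 'X_{1..n}).

Theorem dickson (A : set 'X_{1..n}) : exists2 s : seq 'X_{1..n},
  (forall m, m \in s -> A m) & forall m, A m -> exists2 f, f \in s & (f <= m)%MM.
Proof.
suff H k : forall A : set 'X_{1..n}, exists2 s : seq 'X_{1..n},
    (forall m, m \in s -> A m) &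
    forall m, A m -> exists2 f, f \in s & forall i : 'I_n, (i < k)%N -> (f i <= m i)%N.
  have [s sA As] := H n A; exists s => // m /As[f fs fm].
  by exists f => //; apply/mnm_lepP => i; apply: fm.
elim: k => [|k IHk] {}A.
  have [[m Am]|nA] := pselect (exists m, A m).
    exists [:: m] => [m'|m' _]; first by rewrite inE => /eqP->.
    by exists m; rewrite ?inE.
  by exists [::] => // m Am; case: nA; exists m.
have [s sA As] := IHk A.
have [ltkn|lenk] := ltnP k n; last first.
  exists s => // m /As[f fs fm]; exists f => // i ltik.
  by apply: fm; apply: leq_trans lenk.
pose i0 := Ordinal ltkn.
have /choice[S SP] (c : nat) : exists S : seq 'X_{1..n},
    (forall m, m \in S -> A m /\ m i0 = c) /\
    forall m, A m -> m i0 = c ->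
      exists2 f, f \in S & forall i : 'I_n, (i < k)%N -> (f i <= m i)%N.
  have [S SA AS] := IHk [set m | A m /\ m i0 = c].
  by exists S; split=> // m Am mc; apply: AS.
pose B := \max_(f <- s) f i0.
exists (s ++ flatten [seq S c | c <- iota 0 B]) => [m|m Am].
  rewrite mem_cat => /orP[/sA //|/flatten_mapP[c _ mS]].
  by have [/(_ _ mS)[]] := SP c.
have lt_kS (f : 'X_{1..n}) : (forall i : 'I_n, (i < k)%N -> (f i <= m i)%N) ->
    (f i0 <= m i0)%N -> forall i : 'I_n, (i < k.+1)%N -> (f i <= m i)%N.
  move=> fm fm0 i; rewrite ltnS leq_eqVlt => /orP[/eqP ik|/fm //].
  by have -> : i = i0 by apply: val_inj.
have [leBm|ltmB] := leqP B (m i0).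
  have [f fs fm] := As m Am; exists f; first by rewrite mem_cat fs.
  by apply: lt_kS => //; apply: leq_trans leBm; apply: leq_bigmax_seq.
have [SA /(_ m Am erefl)[f fS fm]] := SP (m i0); exists f.
  rewrite mem_cat; apply/orP; right; apply/flatten_mapP.
  by exists (m i0); rewrite // mem_iota.
by apply: lt_kS => //; have [_ ->] := SA f fS.
Qed.

Lemma seq_maximum (T : eqType) (r : rel T) (s : seq T) : transitive r ->
  total r -> s != [::] -> exists2 y, y \in s & forall z, z \in s -> r z y.
Proof.
move=> rtr rtot; elim: s => // a [|b s] IHs _.
  exists a; rewrite ?inE // => z; rewrite inE => /eqP->.
  by have := rtot a a; rewrite orbb.
have [y ys yP] := IHs isT.
have [ray|/negPf nray] := boolP (r a y).
  exists y; first by rewrite inE ys orbT.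
  by move=> z; rewrite inE => /orP[/eqP->//|/yP].
have rya : r y a by have := rtot a y; rewrite nray.
exists a; first by rewrite inE eqxx.
move=> z; rewrite inE => /orP[/eqP->|/yP zy]; last exact: rtr zy rya.
by have := rtot a a; rewrite orbb.
Qed.

Lemma min_gens_below (K : fieldType) (J : set {mpoly K[n]}) m : J 'X_[m] ->
  exists2 M, min_gens J M & (M <= m)%MM.
Proof.
have [k lemk] := ubnP (mdeg m); elim: k m lemk => // k IHk m lemk Jm.
have [mm|nmm] := pselect (min_gens J m); first by exists m; rewrite ?lepm_refl.
have [m' [Jm' lem' nem']] : exists m', [/\ J 'X_[m'], (m' <= m)%MM & m' != m].
  apply: contrapT => nex; apply: nmm; split=> // m' Jm' lem'.
  by apply: contrapT => /eqP nem'; apply: nex; exists m'.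
have [||M mM leM] := IHk m' => //; last by exists M => //; apply: lepm_trans lem'.
rewrite ltnS in lemk; apply: leq_trans lemk.
rewrite -(submK lem') mdegD -add1n leq_add2r lt0n mdeg_eq0.
by apply: contraNneq nem' => e0; rewrite -(submK lem') e0 add0m.
Qed.

Lemma min_gens_max_exponent (K : fieldType) (J : set {mpoly K[n]}) x M :
  min_gens J M -> (M x <= max_exponent x J)%N.
Proof.
move=> JM; rewrite -leEnat /max_exponent; apply: ge_supremum_Nmem; last by exists M.
have [s sA As] := dickson (min_gens J).
apply: nat_supremums_neq0; exists (\max_(f <- s) f x) => _ [m mm <-].
have [f fs lefm] := As m mm.
have -> : m = f by rewrite (mm.2 f _ lefm) //; have [] := sA f fs.
by rewrite leEnat; apply: leq_bigmax_seq.
Qed.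

Variable le : rel 'X_{1..n}.
Hypothesis leto : term_order le.

Lemma term_order_refl m : le m m.
Proof. by have := term_order_total leto m m; rewrite orbb. Qed.

Lemma term_order_dvd m m' : (m <= m')%MM -> le m m'.
Proof.
move=> lemm'; rewrite -(submK lemm') -{1}[m]add0m.
by apply: term_order_mul => //; exact: term_order_min.
Qed.

Lemma term_order_cancel m m1 m2 : le (m1 + m)%MM (m2 + m)%MM -> le m1 m2.
Proof.
move=> le12; have /orP[//|le21] := term_order_total leto m1 m2.
have := term_order_mul leto m le21 => le21'.
have /eqP : (m1 + m)%MM = (m2 + m)%MM.
  by apply: (term_order_anti leto); rewrite le12.
by rewrite eqm_add2r => /eqP ->; exact: term_order_refl.
Qed.

Lemma term_order_ind (P : 'X_{1..n} -> Prop) :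
  (forall v, (forall w, w != v -> le w v -> P w) -> P v) -> forall v, P v.
Proof.
move=> IH v; apply: contrapT => nPv.
have [s sA As] := dickson [set w | ~ P w].
have s0 : s != [::] by have [f] := As v nPv; case: (s).
have [||w ws wmin] := @seq_maximum _ (fun a b => le b a) s _ _ s0.
- by move=> a b c le1 le2; apply: term_order_trans le2 le1.
- by move=> a b; exact: term_order_total.
apply: (sA w ws); apply: IH => u nuw leuw; apply: contrapT => nPu.
have [f /wmin lewf lefu] := As u nPu; move/eqP: nuw; apply.
apply: (term_order_anti leto); rewrite leuw.
by apply: (term_order_trans leto) lewf _; exact: term_order_dvd.
Qed.

End Monomials.

(** * Initial ideals and Koszul cohomology *)

Lemma sum_neq0 (V : nmodType) (I : Type) (r : seq I) (P : pred I) (F : I -> V) :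
  \sum_(i <- r | P i) F i != 0 -> exists2 i, P i & F i != 0.
Proof.
apply: contra_neqP => nex; apply: big1 => i Pi.
by apply: contrapT => /eqP nF; apply: nex; exists i.
Qed.

Section Ideals.
Variable R : comNzRingType.
Implicit Types (A J : set R).

Definition ideal_set J := @submodule_set R R^o J.

Lemma ideal_gen_ideal A : ideal_set (ideal_gen A).
Proof.
split; first by exists 0%N, (fun=> 0), (fun=> 0); split=> [[]|]; rewrite ?big_ord0.
move=> a _ _ [k [c [g [gA ->]]]] [l [c' [g' [gA' ->]]]].
exists (k + l)%N.
exists (fun i => match fintype.split i with inl i => a * c i | inr i => c' i end).
exists (fun i => match fintype.split i with inl i => g i | inr i => g' i end).
split=> [i|]; first by case: fintype.split.
rewrite big_split_ord /= scaler_sumr; congr (_ + _); apply: eq_bigr => i _.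
  by rewrite (unsplitK (inl i)) -mulrA.
by rewrite (unsplitK (inr i)).
Qed.

Lemma ideal_gen_sub A p : A p -> ideal_gen A p.
Proof.
by move=> Ap; exists 1%N, (fun=> 1), (fun=> p); rewrite big_ord1 mul1r.
Qed.

Lemma idealr_ideal_set (I : idealr R) : ideal_set [set p | p \in I].
Proof.
split=> [|a u v]; first exact: rpred0.
by move=> Iu Iv; apply: rpredD => //; exact: idealMr.
Qed.

Lemma ideal_gen_setU1 J f p : ideal_set J ->
  ideal_gen (J `|` [set f]) p <-> exists2 h, J h & exists g, p = h + f * g.
Proof.
move=> Jid; split.
  move=> [k [c [g [gJ ->]]]]; elim/big_ind: _ => [||i _].
  - by exists 0; [exact: submodule_set0 Jid|exists 0; rewrite mulr0 addr0].
  - move=> _ _ [h Jh [g1 ->]] [h' Jh' [g2 ->]].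
    exists (h + h'); first exact: submodule_setD Jid _ _ Jh Jh'.
    by exists (g1 + g2); rewrite mulrDr addrACA.
  - have [Jg|->] := gJ i.
      exists (c i * g i); first exact: submodule_setZ Jid _ _ Jg.
      by exists 0; rewrite mulr0 addr0.
    exists 0; first exact: submodule_set0 Jid.
    by exists (c i); rewrite add0r mulrC.
move=> [h Jh [g ->]]; have Lid := ideal_gen_ideal (J `|` [set f]).
apply: (submodule_setD Lid); first by apply: ideal_gen_sub; left.
rewrite mulrC; apply: (submodule_setZ Lid); apply: ideal_gen_sub; by right.
Qed.

End Ideals.

Section InitialIdeals.
Variables (K : fieldType) (n : nat).
Local Notation R := {mpoly K[n]}.
Implicit Types (p : R) (J : set R) (m : 'X_{1..n}) (S T : {set 'I_n}).

Lemma mcoeffMXE (p : R) m k :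
  (p * 'X_[m])@_k = if (m <= k)%MM then p@_(k - m) else 0.
Proof.
case: ifP => [lemk|nle]; first by rewrite -{1}(submK lemk) addmC mcoeffMX.
apply/eqP; rewrite mcoeff_eq0 (perm_mem (msuppMX p m)).
by apply/mapP => -[m' _ ek]; rewrite ek lem_addr in nle.
Qed.

Definition monomial_ideal J :=
  ideal_set J /\ forall p m, J p -> m \in msupp p -> J 'X_[m].

Lemma ideal_msupp J p : ideal_set J -> (forall m, m \in msupp p -> J 'X_[m]) -> J p.
Proof.
move=> Jid Jp; rewrite [p]mpolyE big_seq; apply: (submodule_set_sum Jid) => m mp.
by rewrite -mul_mpolyC; apply: (submodule_setZ Jid); apply: Jp.
Qed.

Lemma ideal_mpolyX_dvd J m m' : ideal_set J -> J 'X_[m] -> (m <= m')%MM -> J 'X_[m'].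
Proof.
move=> Jid Jm lemm'; rewrite -(submK lemm') mpolyXD.
exact: (submodule_setZ Jid).
Qed.

Variable le : rel 'X_{1..n}.
Hypothesis leto : term_order le.

Lemma initial_ideal_ideal J : ideal_set (initial_ideal le J).
Proof. exact: ideal_gen_ideal. Qed.

Lemma initial_ideal_lead J p m : J p -> lead_monomial le p m ->
  initial_ideal le J 'X_[m].
Proof. by move=> Jp lpm; apply: ideal_gen_sub; exists m => //; exists p. Qed.

Lemma lead_monomialMX p m k : lead_monomial le p m ->
  lead_monomial le (p * 'X_[k]) (k + m).
Proof.
move=> [mp mmax]; split; first by rewrite mcoeff_msupp mcoeffMX -mcoeff_msupp.
move=> m'; rewrite (perm_mem (msuppMX p k)) => /mapP[m1 /mmax le1 ->].
by rewrite ![(k + _)%MM]addmC; apply: term_order_mul.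
Qed.

Lemma initial_ideal_msupp J p m : ideal_set J ->
  initial_ideal le J p -> m \in msupp p ->
  exists2 p', J p' & lead_monomial le p' m.
Proof.
move=> Jid [k [c [g [gJ ->]]]].
rewrite mcoeff_msupp raddf_sum => /sum_neq0[i _] /=.
have [m' [p1 Jp1 lpm'] <-] := gJ i; rewrite mcoeffMXE.
case: ifP => [lem'm|]; rewrite ?eqxx // => _.
exists (p1 * 'X_[m - m']).
  by rewrite mulrC; apply: (submodule_setZ Jid).
by have := lead_monomialMX (m - m') lpm'; rewrite submK.
Qed.

Lemma initial_ideal_lead_ex J m : ideal_set J -> initial_ideal le J 'X_[m] ->
  exists2 p, J p & lead_monomial le p m.
Proof. by move=> Jid /initial_ideal_msupp; apply; rewrite // msuppX inE. Qed.

Lemma initial_ideal_monomial J : ideal_set J -> monomial_ideal (initial_ideal le J).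
Proof.
move=> Jid; split=> [|p m Jp mp]; first exact: initial_ideal_ideal.
have [p' Jp' lp'] := initial_ideal_msupp Jid Jp mp.
exact: initial_ideal_lead Jp' lp'.
Qed.

Let x (j : 'I_n) : R := 'X_j.
Local Notation "'kd'" := (@kdiff R n x R^o).

Definition colevel (S : {set 'I_n}) : 'X_{1..n} := (\sum_(k in ~: S) U_(k))%MM.

Lemma colevelD1 (S : {set 'I_n}) j : j \in S ->
  colevel (S :\ j) = (U_(j) + colevel S)%MM.
Proof.
move=> jS; rewrite /colevel (bigD1 j) ?inE ?eqxx //=; congr (_ + _)%MM.
apply: eq_bigl => k; rewrite !inE; have [->|] := eqVneq k j; rewrite ?jS //=.
by rewrite andbT.
Qed.

(* The Koszul complex is Z^n-graded; shifting degrees by (1,...,1), the degree of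
   the term m e_S is m + colevel S. *)
Definition level_coef (v : 'X_{1..n}) (c : {set 'I_n} -> R) (S : {set 'I_n}) : K :=
  (c S * 'X_[colevel S])@_v.

Definition level_term (v : 'X_{1..n}) (a : {set 'I_n} -> K) (S : {set 'I_n}) : R :=
  if (colevel S <= v)%MM then a S *: 'X_[v - colevel S] else 0.

Lemma level_coefB v c c' S :
  level_coef v (fun T => c T - c' T) S = level_coef v c S - level_coef v c' S.
Proof. by rewrite /level_coef mulrBl mcoeffB. Qed.

Lemma level_coef_kdiff v c T :
  level_coef v (kd c) T = \sum_(j in T) ksign K j T * level_coef v c (T :\ j).
Proof.
rewrite /level_coef /kdiff mulr_suml raddf_sum; apply: eq_bigr => j jT /=.
rewrite colevelD1 // mpolyXD -mcoeffZ; congr (mcoeff _ _).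
rewrite [_ *: _ in LHS]/GRing.scale /= -mul_mpolyC !mulrA; congr (_ * _).
rewrite mulrAC; congr (_ * _ * _).
by rewrite /ksign rmorphXn rmorphN rmorph1.
Qed.

Lemma level_coef_term v w a S :
  level_coef w (level_term v a) S = if (colevel S <= v)%MM && (w == v) then a S else 0.
Proof.
rewrite /level_coef /level_term; case: ifP => [lev|_]; last by rewrite mul0r mcoeff0.
rewrite -scalerAl -mpolyXD submK // mcoeffZ mcoeffX eq_sym.
by case: eqP; rewrite ?mulr1 ?mulr0.
Qed.

Lemma level_coef_colevel v c S : level_coef v c S != 0 -> (colevel S <= v)%MM.
Proof. by rewrite /level_coef mcoeffMXE; case: ifP; rewrite ?eqxx. Qed.

Lemma level_coef_msupp c S m :
  (m \in msupp (c S)) = (level_coef (colevel S + m)%MM c S != 0).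
Proof. by rewrite /level_coef mcoeffMX -mcoeff_msupp. Qed.

Lemma level_coef_id v c S :
  level_coef v (level_term v (level_coef v c)) S = level_coef v c S.
Proof.
rewrite level_coef_term eqxx andbT; case: ifP => // nle.
by apply/esym/eqP; apply: contraFT nle; exact: level_coef_colevel.
Qed.

Lemma level_coef_max i c : (forall S : {set 'I_n}, #|S| = i -> c S = 0) \/
  exists v, (exists2 S : {set 'I_n}, #|S| = i & level_coef v c S != 0) /\
    forall (S : {set 'I_n}) w, #|S| = i -> level_coef w c S != 0 -> le w v.
Proof.
pose L := flatten [seq [seq (colevel A + m)%MM | m <- msupp (c A)] |
                       A <- enum [pred A : {set 'I_n} | #|A| == i]].
have LP w : reflect (exists2 S : {set 'I_n}, #|S| = i & level_coef w c S != 0) (w \in L).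
  apply: (iffP flatten_mapP) => [[S]|[S cS nwS]].
    rewrite mem_enum => /eqP cS /mapP[m mS ->]; exists S => //.
    by rewrite -level_coef_msupp.
  exists S; first by rewrite mem_enum; apply/eqP.
  have lew := level_coef_colevel nwS; apply/mapP.
  exists (w - colevel S)%MM; last by rewrite addmC submK.
  by rewrite level_coef_msupp addmC submK.
have [L0|nL0] := eqVneq L [::].
  left=> S cS; apply: msuppnil0; case E: (msupp (c S)) => [//|m s].
  have mS : m \in msupp (c S) by rewrite E inE eqxx.
  suff : (colevel S + m)%MM \in L by rewrite L0.
  by apply/LP; exists S; rewrite -?level_coef_msupp.
right; have [v /LP vL vmax] := seq_maximum (term_order_trans leto) (term_order_total leto) nL0.
by exists v; split=> // S w cS nw; apply: vmax; apply/LP; exists S.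
Qed.

(* The leading part of a cocycle mod J is a cocycle mod in(J); subtracting the
   boundary that kills it lowers the level, and levels are well-ordered. *)
Lemma koszul_exact_initial q J : ideal_set J ->
  @koszul_exact R n x R^o q (initial_ideal le J) -> @koszul_exact R n x R^o q J.
Proof.
move=> Jid exq i z leiq zcy.
have inid := @initial_ideal_ideal J.
pose bounded v z := forall (S : {set 'I_n}) w, #|S| = i -> level_coef w z S != 0 -> le w v.
have [z0|[v [_ vz]]] := level_coef_max i z.
  exists (fun=> 0) => T cT; rewrite z0 // /kdiff big1 ?subr0 => [|j _].
    exact: submodule_set0 Jid.
  by rewrite scaler0.
have {vz} : bounded v z := vz.
elim/(term_order_ind leto): v z zcy => v IHv z zcy zv.
have kdv T w : #|T| = i.+1 -> level_coef w (kd z) T != 0 -> le w v.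
  move=> cT; rewrite level_coef_kdiff => /sum_neq0[j jT].
  rewrite mulf_eq0 negb_or => /andP[_]; apply: zv.
  by apply/eqP; rewrite -eqSS -cT [X in _ == X](cardsD1 j) jT.
pose z0 := level_term v (level_coef v z).
have [|y yP] := exq i z0 leiq.
  move=> T cT; apply: (ideal_msupp inid) => m; rewrite level_coef_msupp.
  set w := (colevel T + m)%MM => nw.
  have ewv : w = v.
    move: nw; rewrite level_coef_kdiff => /sum_neq0[j jT].
    rewrite mulf_eq0 negb_or => /andP[_]; rewrite level_coef_term.
    by case: ifP; rewrite ?eqxx // => /andP[_ /eqP].
  apply: (initial_ideal_lead (zcy T cT)); split.
    rewrite level_coef_msupp -/w; move: nw; rewrite !level_coef_kdiff ewv.
    by under eq_bigr do rewrite level_coef_id.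
  move=> m'; rewrite level_coef_msupp => /(kdv _ _ cT).
  rewrite -ewv /w ![(colevel T + _)%MM]addmC; exact: term_order_cancel.
have /choice[p pP] (S : {set 'I_n}) : exists p : R, #|S| = i ->
    [/\ J p, level_coef v (fun=> p) S = level_coef v (fun T => z0 T - kd y T) S &
        forall w, level_coef w (fun=> p) S != 0 -> le w v].
  have [cS|/eqP nS] := eqVneq #|S| i; last by exists 0.
  have [->|nr] := eqVneq (level_coef v (fun T => z0 T - kd y T) S) 0.
    exists 0 => _; split; first exact: submodule_set0 Jid.
      by rewrite /level_coef mul0r mcoeff0.
    by move=> w; rewrite /level_coef mul0r mcoeff0 eqxx.
  have leSv := level_coef_colevel nr.
  set r := level_coef v _ S in nr *.
  have [|p Jp [mp mmax]] := initial_ideal_msupp (m := (v - colevel S)%MM) Jid (yP S cS).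
    by rewrite (level_coef_msupp (fun T => z0 T - kd y T)) addmC submK.
  set m := (v - colevel S)%MM in mp mmax.
  have pm : p@_m != 0 by rewrite -mcoeff_msupp.
  exists ((r / p@_m) *: p) => _; split.
  - by rewrite -mul_mpolyC; apply: (submodule_setZ Jid).
  - by rewrite /level_coef mcoeffMXE leSv mcoeffZ mulfVK.
  - move=> w; rewrite /level_coef mcoeffMXE; case: ifP; rewrite ?eqxx // => leSw.
    rewrite mcoeffZ mulf_eq0 negb_or -mcoeff_msupp => /andP[_ /mmax].
    by move/(term_order_mul leto (colevel S)); rewrite !submK.
pose y0 := level_term v (level_coef v y).
pose z' S := z S - kd y0 S - p S.
have ley0 T w : level_coef w (kd y0) T != 0 -> w = v.
  rewrite level_coef_kdiff => /sum_neq0[j jT].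
  rewrite mulf_eq0 negb_or => /andP[_]; rewrite level_coef_term.
  by case: ifP; rewrite ?eqxx // => /andP[_ /eqP].
have z'cy T : #|T| = i.+1 -> J (kd z' T).
  move=> cT; rewrite !kdiffB kdiff_kdiff subr0.
  apply: (submodule_setB Jid); first exact: zcy.
  apply: (submodule_set_sum Jid) => j jT; apply: (submodule_setZ Jid).
  have [|//] := pP (T :\ j).
  by apply/eqP; rewrite -eqSS -cT [X in _ == X](cardsD1 j) jT.
have z'le : bounded v z'.
  move=> S w cS; rewrite level_coefB level_coefB.
  have [_ _ ple] := pP S cS.
  have [z0w|/zv -> //] := eqVneq (level_coef w z S) 0.
  have [y0w|/ley0 -> _] := eqVneq (level_coef w (kd y0) S) 0; last exact: term_order_refl.
  by rewrite z0w y0w subrr sub0r oppr_eq0; apply: ple.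
have z'v S : #|S| = i -> level_coef v z' S = 0.
  move=> cS; rewrite !level_coefB; have [_ e _] := pP S cS.
  have -> : level_coef v (kd y0) S = level_coef v (kd y) S.
    by rewrite !level_coef_kdiff; under eq_bigr do rewrite level_coef_id.
  by rewrite [level_coef v p S]e level_coefB level_coef_id subrr.
have [y' y'P] : exists y', forall T : {set 'I_n}, #|T| = i -> J (z' T - kd y' T).
  have [z'0|[v' [[S cS nv'] v'z]]] := level_coef_max i z'.
    exists (fun=> 0) => T cT; rewrite z'0 // /kdiff big1 ?subr0 => [|j _].
      exact: submodule_set0 Jid.
    by rewrite scaler0.
  apply: (IHv v') => //; last exact: z'le nv'.
  by apply: contraNneq nv' => ->; rewrite z'v.
exists (fun S => y0 S + y' S) => T cT; rewrite kdiffD.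
have [Jp _ _] := pP T cT.
have := submodule_setD Jid (y'P T cT) Jp; rewrite /z'.
by rewrite addrAC subrK opprD addrA.
Qed.

End InitialIdeals.

(** * Adding a sum of variables to a monomial ideal *)

Section Transfer.
Variables (K : fieldType) (n : nat).
Local Notation R := {mpoly K[n]}.
Implicit Types (p f g : R) (m N M : 'X_{1..n}).

Section Strip.
Variables (B : {set 'I_n}) (N : 'X_{1..n}) (y : 'I_n).
Hypotheses (yB : y \notin B) (Ny : (0 < N y)%N).

Definition same_outside m := [forall z, (z \notin B) ==> (m z == N z)].

Lemma same_outsideP m :
  reflect (forall z, z \notin B -> m z = N z) (same_outside m).
Proof.
apply: (iffP forallP) => mN z; first by move=> zB; apply/eqP/(implyP (mN z)).
by apply/implyP => /mN->.
Qed.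

Lemma same_outside_le m : same_outside m -> (U_(y) <= m)%MM.
Proof. by move=> /same_outsideP/(_ _ yB) mN; rewrite lep1mP mN -lt0n. Qed.

Definition strip p : R :=
  \sum_(m <- msupp p) p@_m *: (if same_outside m then 'X_[m - U_(y)] else 0).

Lemma mcoeff_strip p k :
  (strip p)@_k = if same_outside (k + U_(y)) then p@_(k + U_(y)) else 0.
Proof.
rewrite /strip raddf_sum /=.
under eq_bigr do rewrite mcoeffZ (fun_if (mcoeff k)) mcoeff0 mcoeffX.
have other m : m != (k + U_(y))%MM ->
    p@_m * (if same_outside m then (m - U_(y) == k)%MM%:R else 0) = 0.
  move=> nm; case: ifP => [/same_outside_le leym|]; last by rewrite mulr0.
  case: eqP => [ek|]; last by rewrite mulr0.
  by move: nm; rewrite -ek submK ?eqxx.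
have [kp|nkp] := boolP ((k + U_(y))%MM \in msupp p).
  rewrite (bigD1_seq _ kp) //= big1 => [|m nm]; last exact: other.
  rewrite addr0 addmK eqxx; case: ifP; by rewrite ?mulr1 ?mulr0.
rewrite (memN_msupp_eq0 nkp) if_same big1_seq // => m /= mp; apply: other.
by apply: contraNneq nkp => <-.
Qed.

Lemma stripD p q : strip (p + q) = strip p + strip q.
Proof.
apply/mpolyP => k; rewrite mcoeffD !mcoeff_strip mcoeffD.
by case: ifP; rewrite ?addr0.
Qed.

Lemma strip0 : strip 0 = 0.
Proof. by apply/mpolyP => k; rewrite mcoeff_strip !mcoeff0 if_same. Qed.

Lemma stripM f g : (forall a, a \in msupp f -> forall z, z \notin B -> a z = 0%N) ->
  strip (f * g) = f * strip g.
Proof.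
move=> fB; rewrite {1}[f]mpolyE [in RHS](mpolyE f) !mulr_suml.
rewrite (big_morph strip stripD strip0); apply: eq_big_seq => a /fB aB.
apply/mpolyP => k; rewrite -!scalerAl mcoeff_strip !mcoeffZ.
rewrite !['X_[a] * _]mulrC !mcoeffMXE mcoeff_strip.
have leak : (a <= k + U_(y))%MM = (a <= k)%MM.
  apply/mnm_lepP/mnm_lepP => leak z; have := leak z; rewrite mnmDE mnm1E.
    by have [<-|_] := eqVneq y z; rewrite ?addn0 // aB.
  by move=> leak'; apply: leq_trans leak' (leq_addr _ _).
rewrite leak; have [lea|_] := boolP (a <= k)%MM; last by rewrite mulr0 if_same.
have ek : (k - a + U_(y) = k + U_(y) - a)%MM.
  by rewrite addmC addmBA // [(U_(y) + k)%MM]addmC.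
have -> : same_outside (k + U_(y)) = same_outside (k - a + U_(y)).
  by apply/same_outsideP/same_outsideP => kN z zB;
    have := kN z zB; rewrite !mnmDE mnmBE aB ?subn0.
by rewrite ek; case: ifP; rewrite ?mulr0.
Qed.

End Strip.

Variable le : rel 'X_{1..n}.
Hypothesis leto : term_order le.

(* (J, f) is graded by the exponents of the variables outside B. If x_y divides N
   and no generator of J attains the y-exponent of N, then x_y can be cancelled
   from the outside-degree-N part of any p in (J, f) with leading monomial N. *)
Lemma min_gens_initial_ideal (J : set R) f (B : {set 'I_n}) N y :
  monomial_ideal J ->
  (forall a, a \in msupp f -> forall z, z \notin B -> a z = 0%N) ->
  min_gens (initial_ideal le (ideal_gen (J `|` [set f]))) N ->
  y \notin B -> (0 < N y)%N ->
  exists M, [/\ min_gens J M, M y = N y & forall z, z \notin B -> (M z <= N z)%N].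
Proof.
move=> [Jid Jmon] fB [NL Nmin] yB Ny; apply: contrapT => nM.
set L := ideal_gen _ in NL Nmin; have Lid : ideal_set L by exact: ideal_gen_ideal.
have [p Lp [Np pN]] := initial_ideal_lead_ex leto Lid NL.
have NN : same_outside B N N by apply/same_outsideP.
have leyN : (U_(y) <= N)%MM by exact: same_outside_le NN.
have /(ideal_gen_setU1 _ _ Jid)[h Jh [g pE]] := Lp.
have Jsh : J (strip B N y h).
  apply: (ideal_msupp Jid) => m; rewrite mcoeff_msupp mcoeff_strip //.
  case: ifP => [/same_outsideP mN|]; rewrite ?eqxx // -mcoeff_msupp => /(Jmon _ _ Jh).
  move=> /min_gens_below[M JM /mnm_lepP leM]; apply: (ideal_mpolyX_dvd Jid JM.1).
  have leMN z : z \notin B -> (M z <= N z)%N by move=> zB; rewrite -mN.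
  apply/mnm_lepP => z; have := leM z; rewrite mnmDE mnm1E.
  have [ez _|_] := eqVneq y z; last by rewrite addn0.
  have := mN y yB; rewrite mnmDE mnm1E eqxx addn1 => em; rewrite -ez -ltnS em.
  rewrite ltn_neqAle leMN // andbT; apply/eqP => eM.
  by apply: nM; exists M.
have Lsp : L (strip B N y p).
  rewrite pE stripD // stripM //; apply/(ideal_gen_setU1 _ _ Jid).
  by exists (strip B N y h) => //; exists (strip B N y g).
have lsp : lead_monomial le (strip B N y p) (N - U_(y))%MM.
  split; first by rewrite mcoeff_msupp mcoeff_strip // submK // NN -mcoeff_msupp.
  move=> m; rewrite mcoeff_msupp mcoeff_strip //; case: ifP; rewrite ?eqxx // => _.
  rewrite -mcoeff_msupp => /pN; rewrite -{1}(submK leyN).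
  exact: term_order_cancel.
have := Nmin _ (initial_ideal_lead Lsp lsp) (lem_subr _ _).
move=> /(congr1 (fun m : 'X_{1..n} => m y)) /eqP.
by rewrite mnmBE mnm1E eqxx -{2}(subn0 (N y)) eqn_sub2lE.
Qed.

Lemma regular_sum_vars (J : set R) (t : nat) (b : nat -> 'I_n) :
  monomial_ideal J ->
  (forall j j', (j <= t)%N -> (j' <= t)%N -> b j = b j' -> j = j') ->
  (forall j M, (1 <= j <= t)%N -> min_gens J M -> (M (b j) <= 1)%N) ->
  (forall M, min_gens J M -> (U_(b 0%N) <= M)%MM ->
     exists2 j, (1 <= j <= t)%N & (U_(b j) <= M)%MM) ->
  regular_mod J (\sum_(0 <= j < t.+1) 'X_(b j)).
Proof.
move=> [Jid Jmon] binj bexp bdiv g Jfg; apply: contrapT => nJg.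
pose A := [seq m <- msupp g | `[< ~ J 'X_[m] >]].
have AP m : m \in A <-> ~ J 'X_[m] /\ m \in msupp g.
  by rewrite mem_filter; split=> [/andP[/asboolP]|[/asboolP -> ->]].
have A0 : A != [::].
  apply: contra_notN nJg => /eqP A0; apply: (ideal_msupp Jid) => m mg.
  by apply: contrapT => nJm; have : m \in A by [apply/AP]; rewrite A0.
have lift j m : (j <= t)%N -> m \in A ->
    (forall m', m' \in A -> (m' (b j) <= m (b j))%N) -> J 'X_[m + U_(b j)].
  move=> lejt mA mmax; apply: contrapT => nJ; have /AP[_ mg] := mA.
  apply: (nJ); apply: (Jmon _ _ Jfg); rewrite mcoeff_msupp.
  suff -> : ((\sum_(0 <= k < t.+1) 'X_(b k)) * g)@_(m + U_(b j)) = g@_m.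
    by rewrite -mcoeff_msupp.
  have ltjt : (j < t.+1)%N := lejt.
  rewrite big_mkord mulr_suml raddf_sum /= (bigD1 (Ordinal ltjt)) //= big1 => [|k nkj].
    by rewrite addr0 mulrC mcoeffMXE lem_addl addmK.
  apply: contrapT => /eqP; rewrite mulrC mcoeffMXE; case: ifP => [lek|_]; last first.
    by rewrite eqxx.
  set m' := (_ - _)%MM; rewrite -mcoeff_msupp => m'g.
  have m'A : m' \in A.
    by apply/AP; split=> // Jm'; apply: nJ; apply: (ideal_mpolyX_dvd Jid Jm'); exact: lem_subr.
  have := mmax m' m'A; rewrite mnmBE mnmDE !mnm1E eqxx.
  have [ebk|_] := eqVneq (b k) (b j); last by rewrite subn0 addn1 ltnn.
  by case/eqP: nkj; apply: val_inj; apply: binj; rewrite //= -ltnS.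
have below y m M : min_gens J M -> m \in A -> (M <= m + U_(y))%MM -> (m y < M y)%N.
  move=> JM /AP[nJm _] /mnm_lepP leM; rewrite ltnNge; apply/negP => leMy; apply: nJm.
  apply: (ideal_mpolyX_dvd Jid JM.1); apply/mnm_lepP => z.
  by have := leM z; rewrite mnmDE mnm1E; have [<-|_] := eqVneq y z; rewrite ?addn0.
have maxA y : exists2 m, m \in A & forall m', m' \in A -> (m' y <= m y)%N.
  apply: (@seq_maximum _ (fun m m' : 'X_{1..n} => m y <= m' y)%N) => //.
    by move=> m2 m1 m3; exact: leq_trans.
  by move=> m1 m2; exact: leq_total.
have noB j m : (1 <= j <= t)%N -> m \in A -> m (b j) = 0%N.
  move=> /[dup] jt /andP[_ lejt] mA; have [m1 m1A m1max] := maxA (b j).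
  have /min_gens_below[M JM leM] := lift j m1 lejt m1A m1max.
  have := leq_trans (below _ _ _ JM m1A leM) (bexp j M jt JM).
  rewrite ltnS leqn0 => /eqP m10; apply/eqP; rewrite -leqn0 -m10; exact: m1max.
have [m mA mmax] := maxA (b 0%N).
have /min_gens_below[M JM leM] := lift 0%N m (leq0n t) mA mmax.
have [|j jt] := bdiv M JM.
  by rewrite lep1mP -lt0n; apply: leq_ltn_trans (below _ _ _ JM mA leM).
rewrite lep1mP; move/mnm_lepP/(_ (b j)): leM; rewrite mnmDE (noB j m) // mnm1E.
case: eqP => [eb|_]; last by rewrite leqn0 => ->.
have /andP[j0 lejt] := jt.
by have := binj 0%N j (leq0n t) lejt eb => e0; rewrite -e0 in j0.
Qed.

End Transfer.

(** * Initially regular sequences *)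

Section InitiallyRegularDepth.
Variables (K : fieldType) (n : nat).
Local Notation R := {mpoly K[n]}.
Local Notation "'koszul'" := (@koszul_exact R n (fun j => 'X_j) R^o).

Lemma max_ideal_set_sum f : max_ideal_set f ->
  exists a : 'I_n -> R, f = \sum_j a j * 'X_j.
Proof.
move=> [k [c [g [gX ->]]]]; elim/big_ind: _ => [||i _].
- by exists (fun=> 0); rewrite big1 // => j _; rewrite mul0r.
- move=> _ _ [a ->] [a' ->]; exists (fun j => a j + a' j).
  by rewrite -big_split; apply: eq_bigr => j _; rewrite mulrDl.
- have [j _ <-] := gX i; exists (fun k => if k == j then c i else 0).
  rewrite (bigD1 j) //= eqxx big1 ?addr0 // => l /negPf->.
  by rewrite mul0r.
Qed.

Lemma koszul_exact_ideal_quot q (I : idealr R) :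
  koszul q [set p | p \in I] ->
  koszul_exact (fun j => 'X_j : R) q [set (0 : {ideal_quot I})].
Proof.
pose proj : {rmorphism R -> {ideal_quot I}} := \pi_({ideal_quot I})%qT.
have proj0 u : (proj u == 0) = (u \in I).
  by rewrite -[0](rmorph0 proj) -Quotient.idealrBE subr0.
have projZ (a u : R) : proj (a * u) = a *: proj u by rewrite rmorphM.
move=> exq i c leiq cy; pose c0 T : R := repr (c T).
have c0K T : proj (c0 T) = c T by exact: reprK.
have kdE (e : {set 'I_n} -> R) e' T : (forall S, proj (e S) = e' S) ->
    proj (@kdiff R n (fun j => 'X_j) R^o e T) = kdiff (fun j => 'X_j : R) e' T.
  move=> ee'; rewrite /kdiff rmorph_sum; apply: eq_bigr => j _.
  by rewrite projZ ee'.
have [|c' c'P] := exq i c0 leiq.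
  by move=> T cT; rewrite /= -proj0 (kdE _ _ _ c0K); apply/eqP/cy.
exists (proj \o c') => T cT; apply/eqP.
by rewrite -c0K -(kdE c') // -rmorphB proj0; apply: c'P.
Qed.

Lemma initially_regular_depth (le : nat -> rel 'X_{1..n}) q f (I : idealr R) :
  (forall i, (1 <= i)%N -> term_order (le i)) ->
  initially_regular le q f [set p | p \in I] ->
  le_depth q (depth (max_ideal K n) {ideal_quot I}).
Proof.
move=> leto freg.
apply: (@koszul_exact_depth R n (fun j => 'X_j)) => [j|].
  by apply/asboolP; apply: ideal_gen_sub; exists j.
apply: koszul_exact_ideal_quot.
set I0 := [set p | p \in I].
have I0id : ideal_set I0 by exact: idealr_ideal_set.
have initid i : ideal_set (init_seq le f I0 i).
  by case: i => [|[|i]] //; exact: ideal_gen_ideal.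
suff H k i : (i + k = q)%N -> koszul k (init_seq le f I0 i.+1).
  exact: (koszul_exact_initial (leto 1%N isT) I0id) (H q 0%N _).
elim: k i => [|k IHk] i ikq; first by [].
have [|fm _ regi] := freg i.+1; first by rewrite /= -ikq addnS ltnS leq_addr.
have [a fE] := max_ideal_set_sum fm.
apply: (koszul_exact_regular (initid _) fE regi).
have := IHk i.+1; rewrite addSnnS => /(_ ikq).
move/(koszul_exact_initial (leto i.+2 isT) (ideal_gen_ideal _)).
apply: eq_koszul_exact => p; exact: (@ideal_gen_setU1 _ _ (f i.+1) p (initid i.+1)).
Qed.

End InitiallyRegularDepth.

Section DistinctVariables.
Variables (K : fieldType) (n : nat) (I : idealr {mpoly K[n]}).
Variables (q : nat) (t : nat -> nat) (b : nat -> nat -> 'I_n).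
Hypothesis b_distinct : forall i j i' j',
  (1 <= i <= q)%N -> (j <= t i)%N -> (1 <= i' <= q)%N -> (j' <= t i')%N ->
  b i j = b i' j' -> i = i' /\ j = j'.
Local Notation f := (fun i => \sum_(0 <= j < (t i).+1) 'X_(b i j) : {mpoly K[n]}).
Local Notation I0 := [set p | p \in I].

Definition vars_admissible (J : set {mpoly K[n]}) i :=
  (forall j M, (1 <= j <= t i)%N -> min_gens J M -> (M (b i j) <= 1)%N) /\
  (forall M, min_gens J M -> (U_(b i 0%N) <= M)%MM ->
     exists2 j, (1 <= j <= t i)%N & (U_(b i j) <= M)%MM).

Lemma init_seq_admissible (le : nat -> rel 'X_{1..n}) :
  (forall i, (1 <= i <= q)%N -> term_order (le i)) ->
  (forall i, (1 <= i <= q)%N -> vars_admissible (initial_ideal (le 1%N) I0) i) ->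
  forall i, (1 <= i <= q)%N -> monomial_ideal (init_seq le f I0 i) /\
    forall k, (i <= k <= q)%N -> vars_admissible (init_seq le f I0 i) k.
Proof.
move=> leto adm1; elim=> // -[_ q0|i IHi iq].
  split; first by apply: (initial_ideal_monomial (leto 1%N q0)); exact: idealr_ideal_set.
  by move=> k; exact: adm1.
have [Jmon Jadm] := IHi (ltnW iq).
pose L := ideal_gen (init_seq le f I0 i.+1 `|` [set f i.+1]).
have Lid : ideal_set L by exact: ideal_gen_ideal.
change (monomial_ideal (initial_ideal (le i.+2) L) /\
  forall k, (i.+1 < k <= q)%N -> vars_admissible (initial_ideal (le i.+2) L) k).
split; first exact: initial_ideal_monomial (leto _ iq) _ Lid.
move=> k /andP[ltik lekq].
have [adm_exp adm_div] : vars_admissible (init_seq le f I0 i.+1) k.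
  by apply: Jadm; rewrite ltnW.
pose B := [set b i.+1 j | j : 'I_(t i.+1).+1]%SET.
have fB a : a \in msupp (f i.+1) -> forall z, z \notin B -> a z = 0%N.
  rewrite mcoeff_msupp big_mkord raddf_sum => /sum_neq0[j _] /=.
  rewrite mcoeffX; have [<- _ z zB|_] := eqVneq U_(b i.+1 j)%MM a; last by rewrite eqxx.
  by rewrite mnm1E; case: eqVneq zB => [<-|//]; rewrite imset_f.
have bB j : (j <= t k)%N -> b k j \notin B.
  move=> lejt; apply/imsetP => -[j' _ eb].
  have kq : (1 <= k <= q)%N by rewrite (leq_ltn_trans _ ltik).
  have [ek _] := b_distinct kq lejt (ltnW iq : (1 <= i.+1 <= q)%N) (ltn_ord j' : (j' <= _)%N) eb.
  by rewrite ek ltnn in ltik.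
split=> [j M jt LM|M LM].
  have [->//|Mj] := posnP (M (b k j)).
  have jB : b k j \notin B by apply: bB; case/andP: jt.
  have [M' [JM' <- _]] := min_gens_initial_ideal (leto _ iq) Jmon fB LM jB Mj.
  exact: adm_exp.
rewrite lep1mP -lt0n => M0.
have [M' [JM' e0 leM']] := min_gens_initial_ideal (leto _ iq) Jmon fB LM (bB 0%N isT) M0.
have [|j jt] := adm_div M' JM'; first by rewrite lep1mP -lt0n e0.
rewrite lep1mP -lt0n => M'j; exists j => //.
rewrite lep1mP -lt0n; apply: leq_trans M'j _; apply: leM'.
by apply: bB; case/andP: jt.
Qed.

Lemma initially_regular_sums (le : nat -> rel 'X_{1..n}) :
  (forall i, (1 <= i <= q)%N -> term_order (le i)) ->
  (forall i, (1 <= i <= q)%N -> vars_admissible (initial_ideal (le 1%N) I0) i) ->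
  initially_regular le q f I0.
Proof.
move=> leto adm1 i iq.
have [Jmon /(_ i)[|bexp bdiv]] := init_seq_admissible leto adm1 iq.
  by have /andP[_ ->] := iq; rewrite leqnn.
split.
- apply: (submodule_set_sum (ideal_gen_ideal _)) => j _.
  by apply: ideal_gen_sub; exists (b i j).
- move=> c /(congr1 (mcoeff U_(b i 0%N))) /eqP.
  rewrite big_mkord raddf_sum /= mcoeffC mnm1_eq0 mulr0 big_ord_recl /=.
  rewrite mcoeffXU eqxx big1 ?addr0 ?oner_eq0 // => j _; rewrite mcoeffXU.
  case: eqP => // eb.
  by have [] := b_distinct iq (ltn_ord j : (bump 0 j <= _)%N) iq (leq0n _) eb.
- apply: regular_sum_vars Jmon _ bexp bdiv => j j' jt jt' eb.
  by have [] := b_distinct iq jt iq jt' eb.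
Qed.

End DistinctVariables.

Theorem theorem3p11 (K : fieldType) (n : nat) (I : idealr {mpoly K[n]})
    (le1 : rel 'X_{1..n}) (hle1 : term_order le1)
    (q : nat) (t : nat -> nat) (b : nat -> nat -> 'I_n)
    (b_distinct : forall i j i' j',
       (1 <= i <= q)%N -> (j <= t i)%N -> (1 <= i' <= q)%N -> (j' <= t i')%N ->
       b i j = b i' j' -> i = i' /\ j = j')
    (b_exponent : forall i j, (1 <= i <= q)%N -> (1 <= j <= t i)%N ->
       (max_exponent (b i j) (initial_ideal le1 [set p | p \in I]) <= 1)%N)
    (b_divides : forall i, (1 <= i <= q)%N ->
       forall M, min_gens (initial_ideal le1 [set p | p \in I]) M ->
       (U_(b i 0%N) <= M)%MM ->
       exists2 j, (1 <= j <= t i)%N & (U_(b i j) <= M)%MM) :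
  (forall le : nat -> rel 'X_{1..n},
     le 1%N = le1 ->
     (forall i, (2 <= i <= q)%N -> term_order (le i)) ->
     (forall i j, (1 <= i <= q.-1)%N -> (1 <= j <= t i)%N ->
        term_gt (le i.+1) U_(b i 0%N)%MM U_(b i j)%MM) ->
     initially_regular le q (fun i => \sum_(0 <= j < (t i).+1) 'X_(b i j))
       [set p | p \in I])
  /\ le_depth q (depth (max_ideal K n) {ideal_quot I}).
Proof.
have adm i : (1 <= i <= q)%N -> vars_admissible t b (initial_ideal le1 [set p | p \in I]) i.
  move=> iq; split=> [j M jt JM|]; last exact: b_divides.
  by apply: leq_trans (b_exponent i j iq jt); exact: min_gens_max_exponent.
split=> [le le1E leto _|].
  apply: initially_regular_sums => //; last by rewrite le1E.
  move=> i /andP[]; case: i => // -[|i] _ iq; first by rewrite le1E.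
  by apply: leto; rewrite iq.
apply: (@initially_regular_depth _ _ (fun=> le1)) => //.
exact: initially_regular_sums b_distinct _ _ adm.
Qed.
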